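(* Let $P\bowtie G$ be a Zappa-Szép product of a semigroup $P$ and a group $G$, let $\mathcal{A}$ be a unital C*-algebra, let $X$ be a product system over $P$ with coefficient $\mathcal{A}$, let $\beta$ be a Zappa-Szép action of $G$ on $X$, and suppose that the Zappa-Szép system $(X,G,\beta)$ is homogeneous. Let $\mathcal{B}$ be a unital C*-algebra. Then there is a one-to-one correspondence $\widetilde\Pi$ between the set of all (Toeplitz) representations $\Psi$ of $X\widetilde\bowtie G$ on $\mathcal{B}$ and the set of all covariant representations $(\psi,U)$ of $(X,G,\beta)$ on $\mathcal{B}$. In fact, for a given representation $\Psi$ of $X\widetilde\bowtie G$, one has $$\psi_p(x):=\Psi_p(x\otimes e)\quad(p\in P,\ x\in X_p),\qquad U_g:=\Psi_e(1_{\mathcal{A}}\otimes g)\quad(g\in G).$$ Conversely, given a covariant representation $(\psi,U)$ of $(X,G,\beta)$, one has $$\Psi_p(x\otimes g):=\psi_p(x)U_g\quad(p\in P,\ g\in G,\ x\in X_p).$$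
   Context: Semigroups and groups are discrete, and every semigroup has an identity, written $e$ (the identity of $G$ is also written $e$). Zappa-Szép product. One is given a left action $G\times P\to P$, $(g,p)\mapsto g\cdot p$, and a map $P\times G\to G$, $(p,g)\mapsto g|_p$, such that for all $g,h\in G$, $p,q\in P$: $e\cdot p=p$; $(gh)\cdot p=g\cdot(h\cdot p)$; $g\cdot e=e$; $g|_e=g$; $g\cdot(pq)=(g\cdot p)(g|_p\cdot q)$; $g|_{pq}=(g|_p)|_q$; $e|_p=e$; $(gh)|_p=g|_{h\cdot p}\,h|_p$. Then $P\bowtie G=P\times G$ with product $(p,g)(q,h)=(p(g\cdot q),\,g|_q h)$ is a semigroup with identity $(e,e)$. Product system. An $\mathcal{A}$-correspondence is a right Hilbert $\mathcal{A}$-module with a left action of $\mathcal{A}$ by adjointable operators. A product system over $P$ with coefficient $\mathcal{A}$ is $X=\bigsqcup_{p\in P}X_p$, with each $X_p$ an $\mathcal{A}$-correspondence, with an associative multiplication $X_p\times X_q\to X_{pq}$ such that (1) $X_e=\mathcal{A}$ as an $\mathcal{A}$-correspondence; (2) for all $p,q\in P$ the multiplication extends to a unitary $M_{p,q}:X_p\otimes X_q\to X_{pq}$ (interior tensor product over $\mathcal{A}$); (3) the left and right actions of $\mathcal{A}$ on $X_p$ coincide with the multiplications $X_e\times X_p\to X_p$ and $X_p\times X_e\to X_p$. Zappa-Szép action of $G$ on $X$: a collection $\beta=\{\beta_g\}_{g\in G}$ of maps on $X$ such that (A1) for each $p\in P$, $g\in G$, $\beta_g$ restricts to a $\mathbb{C}$-linear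 map $X_p\to X_{g\cdot p}$; (A2) $\beta_g\circ\beta_h=\beta_{gh}$; (A3) $\beta_e$ is the identity; (A4) each $\beta_g$ is a $*$-automorphism of $X_e=\mathcal{A}$; (A5) $\beta_g(xy)=\beta_g(x)\beta_{g|_p}(y)$ for $x\in X_p$, $y\in X_q$; (A6) $\langle\beta_g(x),\beta_g(y)\rangle=\beta_{g|_p}(\langle x,y\rangle)$ for $x,y\in X_p$. The triple $(X,G,\beta)$ is called a Zappa-Szép system; it is homogeneous if $g\cdot p=p$ for all $g\in G$, $p\in P$. The product system $X\widetilde\bowtie G$ over $P$ (homogeneous case). Let $\mathfrak{A}=\mathcal{A}\rtimes_\beta G$ be the universal (full) crossed product, generated by $\mathcal{A}$ and unitaries $u_g$ with $u_ga=\beta_g(a)u_g$. For $p\in P$ put $Z_p^0=c_{00}(G,X_p)=\operatorname{span}\{x\otimes g:x\in X_p,g\in G\}$ with $(au_h)(x\otimes g)=a\beta_h(x)\otimes h|_p g$, $(x\otimes g)(au_h)=x\beta_g(a)\otimes gh$, $\langle x\otimes g,y\otimes h\rangle=\beta_{g^{-1}}(\langle x,y\rangle)u_{g^{-1}h}$, and let $Z_p$ be its completion in $\|\xi\|=\|\langle\xi,\xi\rangle\|^{1/2}$, an $\mathfrak{A}$-correspondence. $X\widetilde\bowtie G=\bigsqcup_pZ_p$ is the product system over $P$ with coefficient $\mathfrak{A}$ whose multiplication is given by $(x\otimes g)(y\otimes h)=x\beta_g(y)\otimes g|_q h$ ($x\in X_p$, $y\in X_q$), with $Z_e$ identified with $\mathfrak{A}$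 via $a\otimes g\mapsto au_g$. A (Toeplitz) representation of a product system $X$ over $P$ on a C*-algebra $\mathcal{B}$ is a family $\psi=(\psi_p)_{p\in P}$ of linear maps $\psi_p:X_p\to\mathcal{B}$ such that $\psi_e$ is a $*$-homomorphism, $\psi_p(x)\psi_q(y)=\psi_{pq}(xy)$ for $x\in X_p,y\in X_q$, and $\psi_p(x)^*\psi_p(y)=\psi_e(\langle x,y\rangle)$ for $x,y\in X_p$. A covariant representation of $(X,G,\beta)$ on a unital C*-algebra $\mathcal{B}$ is a pair $(\psi,U)$ of a representation $\psi$ of $X$ on $\mathcal{B}$ and a unitary representation $U$ of $G$ on $\mathcal{B}$ with $U_g\psi_p(x)=\psi_{g\cdot p}(\beta_g(x))U_{g|_p}$ for all $p\in P$, $g\in G$, $x\in X_p$ (here $g\cdot p=p$).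
   Formalization: Representations Ψ and ψ are required to be unital in degree e (Ψ_e(1)=1, ψ_e(1)=1); without this the claim fails, since ψ=0 with any U is covariant and Ψ=0 would give the non-unitary U_g=0. *)

(* Defs.v *)
From HB Require Import structures.
From mathcomp Require Import all_boot all_order all_algebra.
From mathcomp Require Import complex.
From mathcomp Require Import all_classical all_reals all_analysis.

Set Implicit Arguments.
Unset Strict Implicit.
Unset Printing Implicit Defensive.

Import GRing.Theory Num.Theory numFieldNormedType.Exports.

Local Open Scope classical_set_scope.
Local Open Scope ring_scope.
Local Open Scope complex_scope.

(** * Unital C*-algebras *)

(* The multiplication and the unit are part of the mixin: a structure joining
   normed modules with rings would be identified by Hierarchy Builder with
   [numDomainType]. The zero algebra is not excluded. *)
HB.mixin Record isCStarAlgebra (R : realType) A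
    of CompleteNormedModule R[i] A := {
  cmul : A -> A -> A;
  cone : A;
  star : A -> A;
  cmulA : forall a b c : A, cmul a (cmul b c) = cmul (cmul a b) c;
  cmul1l : forall a : A, cmul cone a = a;
  cmul1r : forall a : A, cmul a cone = a;
  cmulDl : forall a b c : A, cmul (a + b) c = cmul a c + cmul b c;
  cmulDr : forall a b c : A, cmul a (b + c) = cmul a b + cmul a c;
  cmulZl : forall (k : R[i]) (a b : A), cmul (k *: a) b = k *: cmul a b;
  cmulZr : forall (k : R[i]) (a b : A), cmul a (k *: b) = k *: cmul a b;
  cmul_norm : forall a b : A, `|cmul a b| <= `|a| * `|b|;
  starD : forall a b : A, star (a + b) = star a + star b;
  starZ : forall (k : R[i]) (a : A), star (k *: a) = k^* *: star a;
  starM : forall a b : A, star (cmul a b) = cmul (star b) (star a);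
  starK : forall a : A, star (star a) = a;
  cstar_norm : forall a : A, `|cmul (star a) a| = `|a| ^+ 2
}.

#[short(type="cstarAlgType")]
HB.structure Definition CStarAlgebra (R : realType) :=
  {A of CompleteNormedModule R[i] A & isCStarAlgebra R A}.

Notation "a ** b" := (cmul a b) (at level 40, left associativity).

Definition cstar_pos (R : realType) (A : cstarAlgType R) (a : A) : Prop :=
  exists b : A, a = star b ** b.

(* Homomorphisms of unital C*-algebras are unital. For representations this
   cannot be dropped: the unitaries of a covariant representation are not
   determined by products with a zero, or merely non-unital, representation. *)
Record star_hom (R : realType) (A B : cstarAlgType R) (f : A -> B) : Prop := {
  star_hom_linear : linear f;
  star_hom1 : f cone = cone;
  star_homM : forall a b, f (a ** b) = f a ** f b;
  star_hom_star : forall a, f (star a) = star (f a)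
}.

Record unitary_rep (R : realType) (G : groupType) (B : cstarAlgType R)
    (U : G -> B) : Prop := {
  unitary_rep1 : U 1%g = cone;
  unitary_repM : forall g h, U (g * h)%g = U g ** U h;
  unitary_repVl : forall g, star (U g) ** U g = cone;
  unitary_repVr : forall g, U g ** star (U g) = cone
}.

(* [S] is not contained in a proper closed *-subalgebra. *)
Definition cstar_generates (R : realType) (A : cstarAlgType R) (S : set A) :
    Prop :=
  forall T : set A, closed T -> S `<=` T -> T 0 ->
    (forall a b, T a -> T b -> T (a + b)) ->
    (forall (k : R[i]) a, T a -> T (k *: a)) ->
    (forall a b, T a -> T b -> T (a ** b)) ->
    (forall a, T a -> T (star a)) ->
  T = setT.

(** * Hilbert modules and correspondences *)

Definition lin_span (K : pzRingType) (V : lmodType K) (S : set V) : set V :=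
  [set v | exists (n : nat) (c : 'I_n -> K) (w : 'I_n -> V),
     (forall i, S (w i)) /\ v = \sum_i c i *: w i].

(* Inner products are linear in the second variable; the norm of the module
   is the one given by the inner product, and it is complete. *)
HB.mixin Record isHilbertModule (R : realType) (A : cstarAlgType R) E
    of CompleteNormedModule R[i] E := {
  ract : E -> A -> E;
  ip : E -> E -> A;
  ractDl : forall x y a, ract (x + y) a = ract x a + ract y a;
  ractDr : forall x a b, ract x (a + b) = ract x a + ract x b;
  ractZl : forall (k : R[i]) x a, ract (k *: x) a = k *: ract x a;
  ractZr : forall (k : R[i]) x a, ract x (k *: a) = k *: ract x a;
  ractM : forall x a b, ract x (a ** b) = ract (ract x a) b;
  ract1 : forall x, ract x cone = x;
  ipDr : forall x y z, ip x (y + z) = ip x y + ip x z;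
  ipZr : forall (k : R[i]) x y, ip x (k *: y) = k *: ip x y;
  ip_ract : forall x y a, ip x (ract y a) = ip x y ** a;
  ip_star : forall x y, star (ip x y) = ip y x;
  ip_pos : forall x, cstar_pos (ip x x);
  ip_norm : forall x, `|x| ^+ 2 = `|ip x x|
}.

#[short(type="hilbertModType")]
HB.structure Definition HilbertModule (R : realType) (A : cstarAlgType R) :=
  {E of CompleteNormedModule R[i] E & isHilbertModule R A E}.

(* [lact a] is adjointable with adjoint [lact (star a)]: the left action is a
   *-homomorphism into the adjointable operators. *)
HB.mixin Record isCorrespondence (R : realType) (A : cstarAlgType R) E
    of HilbertModule R A E := {
  lact : A -> E -> E;
  lactDl : forall a b x, lact (a + b) x = lact a x + lact b x;
  lactDr : forall a x y, lact a (x + y) = lact a x + lact a y;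
  lactZl : forall (k : R[i]) a x, lact (k *: a) x = k *: lact a x;
  lactZr : forall (k : R[i]) a x, lact a (k *: x) = k *: lact a x;
  lactM : forall a b x, lact (a ** b) x = lact a (lact b x);
  lact_ract : forall a x b, lact a (ract x b) = ract (lact a x) b;
  ip_lact : forall a x y, ip (lact a x) y = ip x (lact (star a) y)
}.

#[short(type="correspondenceType")]
HB.structure Definition Correspondence (R : realType) (A : cstarAlgType R) :=
  {E of HilbertModule R A E & isCorrespondence R A E}.

Record hilbert_unitary (R : realType) (A : cstarAlgType R)
    (E F : hilbertModType A) (f : E -> F) : Prop := {
  hilbert_unitary_linear : linear f;
  hilbert_unitary_ract : forall x a, f (ract x a) = ract (f x) a;
  hilbert_unitary_ip : forall x y : E, ip (f x) (f y) = ip x y :> A;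
  hilbert_unitary_bij : bijective f
}.

(* [T], with [tau x y] playing the role of the elementary tensor of [x] and
   [y], is the interior tensor product of [E] and [F] over [A]. *)
Record interior_tensor (R : realType) (A : cstarAlgType R)
    (E F T : correspondenceType A) (tau : E -> F -> T) : Prop := {
  interior_tensor_linl : forall y, linear (tau^~ y);
  interior_tensor_linr : forall x, linear (tau x);
  interior_tensor_balanced : forall x a y, tau (ract x a) y = tau x (lact a y);
  interior_tensor_ip : forall x y x' y',
    ip (tau x y) (tau x' y') = ip y (lact (ip x x') y') :> A;
  interior_tensor_lact : forall a x y, lact a (tau x y) = tau (lact a x) y;
  interior_tensor_ract : forall a x y, ract (tau x y) a = tau x (ract y a);
  interior_tensor_dense :
    closure (lin_span [set t | exists x y, t = tau x y]) = setT
}.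

(** * Product systems *)

(* The element of the disjoint union of the fibers given by an element of one
   fiber. Two fibers whose indices are only provably equal are distinct types,
   so equations such as associativity are equations in the disjoint union. *)
Definition in_union (I : Type) (R : realType) (A : cstarAlgType R)
    (X : I -> correspondenceType A) (p : I) (x : X p) : {p : I & X p} :=
  existT (fun p => X p : Type) p x.
Arguments in_union {I R A} X {p} x.

Record productSystem (P : monoidType) (R : realType) (A : cstarAlgType R) :=
    ProductSystem {
  ps_fiber :> P -> correspondenceType A;
  ps_mul : forall p q, ps_fiber p -> ps_fiber q -> ps_fiber (p * q)%g;
  ps_mulA : forall p q r (x : ps_fiber p) (y : ps_fiber q) (z : ps_fiber r),
    in_union ps_fiber (ps_mul x (ps_mul y z)) =
    in_union ps_fiber (ps_mul (ps_mul x y) z);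
  (* the identification of [A], as a correspondence over itself, with the
     fiber at the identity *)
  ps_unit : A -> ps_fiber 1%g;
  ps_unit_linear : linear ps_unit;
  ps_unit_bij : bijective ps_unit;
  ps_unit_ip : forall a b, ip (ps_unit a) (ps_unit b) = star a ** b :> A;
  ps_unit_lact : forall a b, lact a (ps_unit b) = ps_unit (a ** b);
  ps_unit_ract : forall a b, ract (ps_unit a) b = ps_unit (a ** b);
  ps_unitary : forall p q,
    exists (T : correspondenceType A) (tau : ps_fiber p -> ps_fiber q -> T),
      interior_tensor tau /\
      exists M : T -> ps_fiber (p * q)%g,
        hilbert_unitary M /\ forall x y, M (tau x y) = ps_mul x y;
  ps_mul_unitl : forall p a (x : ps_fiber p),
    in_union ps_fiber (ps_mul (ps_unit a) x) = in_union ps_fiber (lact a x);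
  ps_mul_unitr : forall p a (x : ps_fiber p),
    in_union ps_fiber (ps_mul x (ps_unit a)) = in_union ps_fiber (ract x a)
}.
Arguments ps_unit {P R A} X a : rename.

(** * Zappa-Szép products and actions *)

(* [zs_act g p] is g.p and [zs_res g p] is g|_p. *)
Record zappaSzep (P : monoidType) (G : groupType) := ZappaSzep {
  zs_act : G -> P -> P;
  zs_res : G -> P -> G;
  zs_act1 : forall p, zs_act 1%g p = p;
  zs_actM : forall g h p, zs_act (g * h)%g p = zs_act g (zs_act h p);
  zs_act_e : forall g, zs_act g 1%g = 1%g;
  zs_res_e : forall g, zs_res g 1%g = g;
  zs_act_mul : forall g p q,
    zs_act g (p * q)%g = (zs_act g p * zs_act (zs_res g p) q)%g;
  zs_res_mul : forall g p q, zs_res g (p * q)%g = zs_res (zs_res g p) q;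
  zs_res1 : forall p, zs_res 1%g p = 1%g;
  zs_resM : forall g h p,
    zs_res (g * h)%g p = (zs_res g (zs_act h p) * zs_res h p)%g
}.

(* [zs_coef g] is the restriction of [zs_beta g] to the coefficient algebra,
   that is to the fiber at the identity. *)
Record zsAction (P : monoidType) (G : groupType) (zs : zappaSzep P G)
    (R : realType) (A : cstarAlgType R) (X : productSystem P A) := ZSAction {
  zs_beta : forall (g : G) (p : P), X p -> X (zs_act zs g p);
  zs_coef : G -> A -> A;
  zs_beta_linear : forall g p, linear (@zs_beta g p);
  zs_betaM : forall g h p (x : X p),
    in_union X (zs_beta g (zs_beta h x)) = in_union X (zs_beta (g * h)%g x);
  zs_beta1 : forall p (x : X p), in_union X (zs_beta 1%g x) = in_union X x;
  zs_beta_coef : forall g a,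
    in_union X (zs_beta g (ps_unit X a)) = in_union X (ps_unit X (zs_coef g a));
  zs_coef_hom : forall g, star_hom (zs_coef g);
  zs_coef_bij : forall g, bijective (zs_coef g);
  zs_beta_mul : forall g p q (x : X p) (y : X q),
    in_union X (zs_beta g (ps_mul x y)) =
    in_union X (ps_mul (zs_beta g x) (zs_beta (zs_res zs g p) y));
  zs_beta_ip : forall g p (x y : X p),
    ip (zs_beta g x) (zs_beta g y) = zs_coef (zs_res zs g p) (ip x y) :> A
}.

Definition homogeneous (P : monoidType) (G : groupType) (zs : zappaSzep P G) :
    Prop :=
  forall (g : G) (p : P), zs_act zs g p = p.

(** * The product system over [P] attached to a homogeneous system *)

(* The full crossed product of [A] by the action [alpha] of [G]. *)
Record crossedProduct (R : realType) (A : cstarAlgType R) (G : groupType)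
    (alpha : G -> A -> A) := CrossedProduct {
  cp_alg :> cstarAlgType R;
  cp_coef : A -> cp_alg;
  cp_grp : G -> cp_alg;
  cp_coef_hom : star_hom cp_coef;
  cp_grp_rep : unitary_rep cp_grp;
  cp_cov : forall g a, cp_grp g ** cp_coef a = cp_coef (alpha g a) ** cp_grp g;
  cp_generated : cstar_generates (range cp_coef `|` range cp_grp);
  cp_universal : forall (C : cstarAlgType R) (pi : A -> C) (V : G -> C),
    star_hom pi -> unitary_rep V ->
    (forall g a, V g ** pi a = pi (alpha g a) ** V g) ->
    exists Phi : cp_alg -> C,
      [/\ star_hom Phi, forall a, Phi (cp_coef a) = pi a
        & forall g, Phi (cp_grp g) = V g]
}.
Arguments cp_coef {R A G alpha} c a.
Arguments cp_grp {R A G alpha} c g.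

(* [tw_tens x g] is the elementary tensor of [x] and [g]. A fiber is the
   completion of the span of these elements: it is complete by definition of
   a correspondence, the span is dense in it, and the inner product and the
   actions are given by the formulas below. In the homogeneous case [g.p] and
   [p] are equal, and both sides of each equation lie over the same index. *)
Record twistedSystem (P : monoidType) (G : groupType) (zs : zappaSzep P G)
    (R : realType) (A : cstarAlgType R) (X : productSystem P A)
    (beta : zsAction zs X) (AG : crossedProduct (zs_coef beta)) :=
    TwistedSystem {
  tw_sys :> productSystem P AG;
  tw_tens : forall p, X p -> G -> tw_sys p;
  tw_tens_linear : forall p g, linear (fun x : X p => tw_tens x g);
  tw_tens_dense : forall p,
    closure (lin_span [set z | exists (x : X p) (g : G), z = tw_tens x g])
    = setT;
  tw_lact : forall p a h (x : X p) g,
    in_union tw_sys (lact (cp_coef AG a ** cp_grp AG h) (tw_tens x g)) =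
    in_union tw_sys
      (tw_tens (lact a (zs_beta beta h x)) (zs_res zs h p * g)%g);
  tw_ract : forall p (x : X p) g a h,
    ract (tw_tens x g) (cp_coef AG a ** cp_grp AG h) =
    tw_tens (ract x (zs_coef beta g a)) (g * h)%g;
  tw_ip : forall p (x y : X p) g h,
    ip (tw_tens x g) (tw_tens y h) =
    cp_coef AG (zs_coef beta g^-1%g (ip x y)) ** cp_grp AG (g^-1 * h)%g :> AG;
  tw_mul : forall p q (x : X p) (y : X q) g h,
    in_union tw_sys (ps_mul (tw_tens x g) (tw_tens y h)) =
    in_union tw_sys
      (tw_tens (ps_mul x (zs_beta beta g y)) (zs_res zs g q * h)%g);
  tw_unit : forall a g,
    ps_unit tw_sys (cp_coef AG a ** cp_grp AG g) = tw_tens (ps_unit X a) g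
}.
Arguments tw_tens {P G zs R A X beta AG} Z {p} x g : rename.

(** * Representations *)

Record toeplitz_rep (P : monoidType) (R : realType) (A : cstarAlgType R)
    (X : productSystem P A) (B : cstarAlgType R) (psi : forall p, X p -> B) :
    Prop := {
  toeplitz_linear : forall p, linear (psi p);
  toeplitz_hom : star_hom (fun a => psi 1%g (ps_unit X a));
  toeplitz_mul : forall p q (x : X p) (y : X q),
    psi p x ** psi q y = psi (p * q)%g (ps_mul x y);
  toeplitz_ip : forall p (x y : X p),
    star (psi p x) ** psi p y = psi 1%g (ps_unit X (ip x y))
}.

Record covariant_rep (P : monoidType) (G : groupType) (zs : zappaSzep P G)
    (R : realType) (A : cstarAlgType R) (X : productSystem P A)
    (beta : zsAction zs X) (B : cstarAlgType R)
    (psi : forall p, X p -> B) (U : G -> B) : Prop := {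
  covariant_toeplitz : toeplitz_rep psi;
  covariant_unitary : unitary_rep U;
  covariant_rel : forall p g (x : X p),
    U g ** psi p x = psi (zs_act zs g p) (zs_beta beta g x) ** U (zs_res zs g p)
}.

(* Main.v *)
(* From a representation Psi of the twisted system one gets the covariance of
   (psi, U) by comparing the two products of x (x) e with 1 (x) g, and
   Psi (x (x) g) = psi x U_g, so that Psi is determined by (psi, U) on the dense
   span of the elementary tensors, hence everywhere, by continuity.
   Conversely let Phi be the homomorphism of the crossed product given by
   (psi_e, U). On a finite sum xi of elementary tensors, b = sum psi(x_i) U_(g_i)
   satisfies b^* b = Phi <xi, xi>, so |b| <= c |xi| and xi |-> b is well defined
   and extends to the completion; the identities of a representation pass to
   the limit.
   Two facts replace spectral theory and the positivity of inner products. A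
   selfadjoint h of norm at most 1/2 is (u + u^* )/2 for a unitary u, so a linear
   map bounded on unitaries is bounded: this applies to *-homomorphisms and to
   the left action on a vector. Polarization gives |<x, y>| <= 4 |x| |y|. These
   crude constants suffice, since only continuity is used. *)

From HB Require Import structures.
Require Import Defs.
From mathcomp Require Import all_boot all_order all_algebra.
From mathcomp Require Import all_classical all_reals all_analysis.
From mathcomp Require Import complex ring.

Set Implicit Arguments.
Unset Strict Implicit.
Unset Printing Implicit Defensive.

Import Order.TTheory GRing.Theory Num.Theory numFieldNormedType.Exports.

Local Open Scope classical_set_scope.
Local Open Scope ring_scope.
Local Open Scope complex_scope.

(** * Maps between normed modules *)

Definition pack_linear (K : pzRingType) (U V : lmodType K) (f : U -> V)
    (lf : linear f) : {linear U -> V} :=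
  HB.pack f (GRing.isLinear.Build _ _ _ _ _ lf).

Section LinearFunctions.
Variables (K : pzRingType) (U V : lmodType K) (f : U -> V).
Hypothesis lf : linear f.

Lemma linear_fun0 : f 0 = 0.
Proof. exact: (linear0 (pack_linear lf)). Qed.

Lemma linear_funD x y : f (x + y) = f x + f y.
Proof. exact: (linearD (pack_linear lf)). Qed.

Lemma linear_funB x y : f (x - y) = f x - f y.
Proof. exact: (linearB (pack_linear lf)). Qed.

Lemma linear_funZ k x : f (k *: x) = k *: f x.
Proof. exact: (linearZ_LR (pack_linear lf)). Qed.

Lemma linear_fun_sum (I : Type) (r : seq I) (Q : pred I) (F : I -> U) :
  f (\sum_(i <- r | Q i) F i) = \sum_(i <- r | Q i) f (F i).
Proof. exact: (linear_sum (pack_linear lf)). Qed.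

End LinearFunctions.

(** The order of [K] is only partial, but positive elements are comparable, so of two sets of the
    family with positive indices one contains the other. *)
Lemma proper_filter_from_pos (K : numFieldType) (T : Type) (B : K -> set T) :
  (forall e e', 0 < e -> e <= e' -> B e `<=` B e') ->
  (forall e, 0 < e -> B e !=set0) ->
  ProperFilter (filter_from [set e | 0 < e] B).
Proof.
move=> Bmono Bn0; apply: filter_from_proper => //.
apply: filter_from_filter; first by exists 1 => /=.
move=> e e' /= e0 e'0.
have [le|/ltW le] := real_leP (gtr0_real e0) (gtr0_real e'0).
  by exists e => // x Bx; split=> //; exact: Bmono Bx.
by exists e' => // x Bx; split=> //; exact: Bmono Bx.
Qed.

Lemma lipschitz_bound_continuous (K : numFieldType) (V W : normedModType K)
    (f : V -> W) (C : K) :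
  (forall x y, `|f x - f y| <= C * `|x - y|) -> continuous f.
Proof.
move=> fC x; apply/(@cvgrPdist_lt _ _ _ (nbhs x)) => e e0; near=> y.
have C1 : 0 < `|C| + 1 by rewrite ltr_wpDl.
apply: (le_lt_trans (fC x y)).
apply: (@le_lt_trans _ _ ((`|C| + 1) * `|x - y|)).
  (* [C] carries no sign hypothesis. A product that bounds a norm is nonnegative, hence equals its
     own norm, so [C] may be replaced by its norm. *)
  have h0 : 0 <= C * `|x - y| by exact: le_trans (fC x y).
  rewrite -(ger0_norm h0) normrM normr_id.
  by rewrite ler_wpM2r// lerDl.
rewrite mulrC -ltr_pdivlMr//.
by near: y; apply: cvgr_dist_lt => //; rewrite divr_gt0.
Unshelve. all: by end_near. Qed.

Lemma linear_bound_continuous (K : numFieldType) (V W : normedModType K)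
    (f : V -> W) (C : K) :
  linear f -> (forall x, `|f x| <= C * `|x|) -> continuous f.
Proof.
move=> lf fC; apply: (@lipschitz_bound_continuous _ _ _ _ C) => x y.
by rewrite -(linear_funB lf).
Qed.

Lemma closed_eq_continuous (K : numFieldType) (V W : normedModType K)
    (f g : V -> W) : continuous f -> continuous g -> closed [set v | f v = g v].
Proof.
move=> cf cg.
have -> : [set v | f v = g v] = (fun v => f v - g v) @^-1` [set 0].
  apply/seteqP; split=> v /= => [->|/eqP]; first by rewrite subrr.
  by rewrite subr_eq0 => /eqP.
apply: closed_comp; last first.
  by apply: accessible_closed_set1; apply: hausdorff_accessible; exact: norm_hausdorff.
by move=> v _; apply: cvgB; [exact: cf|exact: cg].
Qed.

(** The equalizer of [f] and [g] is closed and contains the span of [S]. Identities known on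
    elementary tensors reach the completion this way. *)
Lemma eq_linear_dense (K : numFieldType) (V W : normedModType K)
    (S : set V) (f g : V -> W) :
  closure (lin_span S) = setT -> linear f -> linear g ->
  continuous f -> continuous g -> (forall v, S v -> f v = g v) -> f =1 g.
Proof.
move=> dS lf lg cf cg fg v.
have : closure (lin_span S) v by rewrite dS.
rewrite [closure (lin_span S)]closureE => /(_ [set v | f v = g v]).
apply; split; first exact: closed_eq_continuous.
move=> _ [n [c [w [Sw ->]]]] /=.
rewrite (linear_fun_sum lf) (linear_fun_sum lg); apply: eq_bigr => i _.
by rewrite (linear_funZ lf) (linear_funZ lg) fg.
Qed.

Lemma ler_pos_mulW (K : numFieldType) (x y c : K) : 0 <= c ->
  (forall e, 0 < e -> x <= y + e * c) -> x <= y.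
Proof.
move=> c0 h; apply/ler_addgt0Pr => e e0.
have c1 : 0 < c + 1 by rewrite ltr_wpDl.
apply: (le_trans (h (e / (c + 1)) _)); first by rewrite divr_gt0.
rewrite lerD2l mulrAC ler_pdivrMr//.
by rewrite ler_wpM2l// ?lerDl// ltW.
Qed.

Lemma cvg_dist_ex (K : numFieldType) (V : normedModType K) (F : set_system V)
    (FF : ProperFilter F) (l : V) (A : set V) (e : K) :
  F --> l -> F A -> 0 < e -> exists2 w, A w & `|l - w| < e.
Proof.
move=> /(@cvgrPdist_lt _ _ _ F) h FA e0.
have : F (A `&` [set w | `|l - w| < e]) by apply: filterI => //; exact: h.
by move/filter_ex => [w []]; exists w.
Qed.

(* The closure of a bounded, densely defined linear relation is the graph of a
   bounded linear map. *)
Lemma bounded_relation_extension (K : numFieldType) (V : normedModType K)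
    (W : completeNormedModType K) (D : V -> W -> Prop) (C : K) :
  (forall k v v' w w', D v w -> D v' w' -> D (k *: v + v') (k *: w + w')) ->
  (forall v w, D v w -> `|w| <= C * `|v|) ->
  closure [set v | exists w, D v w] = setT ->
  exists f : V -> W,
    [/\ linear f, continuous f & forall v w, D v w -> f v = w].
Proof.
move=> Dlin DC' Dd.
pose C' := `|C|.
have C0 : 0 <= C' by rewrite /C'.
have DC v w : D v w -> `|w| <= C' * `|v|.
  move=> /DC' h; have h0 : 0 <= C * `|v| by exact: le_trans h.
  by apply: (le_trans h); rewrite -(ger0_norm h0) normrM normr_id.
have DB v v' w w' : D v w -> D v' w' -> D (v - v') (w - w').
  move=> h h'; have := Dlin (-1) v' v w' w h' h.
  by rewrite !scaleN1r ![- _ + _]addrC.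
have Dlip v v' w w' : D v w -> D v' w' -> `|w - w'| <= C' * `|v - v'|.
  by move=> h h'; apply: DC; exact: DB.
have Dnear v e : 0 < e -> exists v' w', D v' w' /\ `|v - v'| < e.
  move=> e0; have : closure [set v | exists w, D v w] v by rewrite Dd.
  move=> /(_ (ball v e) (nbhsx_ballx _ _ e0)) [v' [[w' Dv'] bv']].
  by exists v', w'; split=> //; move: bv'; rewrite -ball_normE.
(* The value at [v] is the limit of the second components of pairs whose first component approaches
   [v]. The estimate against all pairs is the only property of this limit used afterwards. *)
have exb v : exists b, forall v' w', D v' w' -> `|b - w'| <= C' * `|v - v'|.
  pose B e := [set w | exists v', D v' w /\ `|v - v'| < e].
  have PF : ProperFilter (filter_from [set e | 0 < e] B).
    apply: proper_filter_from_pos.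
      move=> e e' e0 le w [v' [Dv' lv']]; exists v'; split=> //.
      exact: lt_le_trans le.
    by move=> e /(Dnear v) [v' [w' [? ?]]]; exists w', v'.
  have : cvg (filter_from [set e | 0 < e] B).
    apply: cauchy_cvg; apply: cauchy_exP => e e0.
    (* Two first components within this radius of [v] are at most twice the radius apart, so their
       second components differ by less than [e]. *)
    have d0 : 0 < e / (1 + (C' + C')).
      by rewrite divr_gt0// ltr_wpDr// addr_ge0.
    have [v0 [w0 [D0 l0]]] := Dnear v _ d0.
    exists w0, (e / (1 + (C' + C'))) => //= w [v' [Dv' l']].
    rewrite -ball_normE /=.
    apply: (le_lt_trans (Dlip _ _ _ _ D0 Dv')).
    apply: (@le_lt_trans _ _ (e / (1 + (C' + C')) * (C' + C'))).
      rewrite [leRHS]mulrDr -mulrDl [leRHS]mulrC ler_wpM2l// -(subrKA v).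
      apply: (le_trans (ler_normD _ _)); rewrite [`|v0 - v|]distrC.
      by rewrite lerD// ltW.
    rewrite mulrAC ltr_pdivrMr; last by rewrite ltr_wpDr// addr_ge0.
    by rewrite ltr_pM2l// ltrDr.
  move=> /cvg_ex [b cb]; exists b => v' w' Dv'.
  apply: (@ler_pos_mulW _ _ _ (1 + C')) => [|e e0]; first by rewrite addr_ge0.
  have FB : filter_from [set e | 0 < e] B (B e) by exists e.
  have [w [v'' [Dv'' lv'']] bw] := cvg_dist_ex PF cb FB e0.
  rewrite -(subrKA w); apply: (le_trans (ler_normD _ _)).
  have h1 := Dlip _ _ _ _ Dv'' Dv'.
  have h2 : `|v'' - v'| <= `|v - v''| + `|v - v'|.
    by rewrite -(subrKA v); apply: (le_trans (ler_normD _ _)); rewrite distrC.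
  apply: (@le_trans _ _ (e + C' * (e + `|v - v'|))).
    apply: lerD; first exact: ltW.
    apply: (le_trans h1); rewrite ler_wpM2l//; apply: (le_trans h2).
    by rewrite lerD2r ltW.
  by rewrite le_eqVlt; apply/orP; left; apply/eqP; ring.
have [f fP] := choice exb.
(* Both [f (k *: x + y)] and [k *: f x + f y] are compared with [k *: w1 + w2] for pairs near [x]
   and [y]; each comparison costs at most [e * (C' * (|k| + 1))]. *)
have lf : linear f.
  move=> k x y; apply/eqP; rewrite -subr_eq0 -normr_le0.
  apply: (@ler_pos_mulW _ _ _ ((C' * (`|k| + 1)) *+ 2)) => [|e e0].
    by rewrite mulrn_wge0// mulr_ge0// addr_ge0.
  have [x' [w1 [D1 l1]]] := Dnear x e e0.
  have [y' [w2 [D2 l2]]] := Dnear y e e0.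
  have split_norm (T : normedModType K) (u v u' v' : T) :
      `|k *: u + v - (k *: u' + v')| <= `|k| * `|u - u'| + `|v - v'|.
    by rewrite opprD addrACA -scalerBr -normrZ ler_normD.
  rewrite add0r -(subrKA (k *: w1 + w2)).
  rewrite [_ *+ 2](_ : _ = C' * (`|k| + 1) + (`|k| * C' + C')); last by ring.
  rewrite mulrDr; apply: (le_trans (ler_normD _ _)); apply: lerD.
    apply: (le_trans (fP _ _ _ (Dlin k _ _ _ _ D1 D2))).
    rewrite mulrCA ler_wpM2l// mulrDr mulr1 [e * _]mulrC.
    apply: (le_trans (split_norm _ _ _ _ _)); apply: lerD; last exact: ltW.
    by rewrite ler_wpM2l// ltW.
  rewrite distrC; apply: (le_trans (split_norm _ _ _ _ _)).
  rewrite mulrDr mulrCA; apply: lerD.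
    rewrite ler_wpM2l//; apply: (le_trans (fP _ _ _ D1)).
    by rewrite mulrC ler_wpM2r// ltW.
  by apply: (le_trans (fP _ _ _ D2)); rewrite mulrC ler_wpM2r// ltW.
exists f; split=> //.
  apply: (@linear_bound_continuous _ _ _ _ C') => // x.
  (* Subtracting any pair of the relation from itself puts [(0, 0)] in it, and [fP] against this
     pair is the bound on [f]. *)
  have [v [w [Dv _]]] := Dnear 0 1 ltr01.
  by have := fP x _ _ (DB _ _ _ _ Dv Dv); rewrite !subrr !subr0.
move=> v w /(fP v); rewrite subrr normr0 mulr0 normr_le0 subr_eq0.
by move/eqP.
Qed.

(** Banach's theorem with ratio one half, using the filter of approximate fixed points: two points
    that [f] moves by less than [e] are at most [e *+ 4] apart. The archimedean hypothesis provides
    iterates that are approximate fixed points. *)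
Lemma contraction_fixpoint (K : numFieldType) (V : completeNormedModType K)
    (U : set V) (f : V -> V) (x0 : V) :
  (forall c : K, 0 <= c -> exists n, c < n%:R) ->
  closed U -> U x0 -> (forall x, U x -> U (f x)) ->
  (forall x y, U x -> U y -> `|f x - f y| *+ 2 <= `|x - y|) ->
  exists2 x, U x & f x = x.
Proof.
move=> archiK clU U0 fU f2.
pose B e := [set y | U y /\ `|f y - y| < e].
have Uit n : U (iter n f x0) by elim: n => //= n; exact: fU.
have PF : ProperFilter (filter_from [set e | 0 < e] B).
  apply: proper_filter_from_pos.
    by move=> e e' e0 le y [Uy ly]; split=> //; exact: lt_le_trans le.
  move=> e e0.
  pose c := `|f x0 - x0|.
  have itn n : `|f (iter n f x0) - iter n f x0| *+ 2 ^ n <= c.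
    elim: n => [|n IH]; first by rewrite expn0 mulr1n.
    rewrite expnS mulrnA; apply: le_trans IH.
    rewrite lerMn2r; apply/orP; right.
    by apply: (f2 (iter n.+1 f x0) (iter n f x0)); exact: Uit.
  have ce : 0 <= c / e by apply: divr_ge0; [exact: normr_ge0|exact: ltW].
  have [n h] := archiK _ ce.
  exists (iter n f x0); split=> //.
  have := itn n; rewrite -mulr_natr => h'.
  have n2 : 0 < (2 ^ n)%:R :> K by rewrite ltr0n expn_gt0.
  (* The iterate is moved by at most [c / 2 ^ n], which is below [e] because [c / e < n < 2 ^ n]. *)
  move: h'; rewrite -ler_pdivlMr// => /le_lt_trans; apply.
  rewrite ltr_pdivrMr//; move: h; rewrite ltr_pdivrMr// mulrC => /lt_trans; apply.
  by rewrite ltr_pM2l// ltr_nat ltn_expl.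
have dist e x y : B e x -> B e y -> `|x - y| <= e *+ 4.
  move=> [Ux lx] [Uy ly].
  have h1 : `|x - y| <= e + `|f x - f y| + e.
    rewrite -[x - y](subrKA (f x)) -(subrKA (f y) (f x)).
    rewrite -[leRHS]addrA; apply: (le_trans (ler_normD _ _)); apply: lerD.
      by rewrite distrC ltW.
    by apply: (le_trans (ler_normD _ _)); rewrite lerD2l ltW.
  have h2 := f2 _ _ Ux Uy.
  have h3 : `|x - y| *+ 2 <= e *+ 4 + `|x - y|.
    apply: le_trans (_ : (e + `|f x - f y| + e) *+ 2 <= _).
      by rewrite lerMn2r h1 orbT.
    apply: le_trans (_ : e *+ 4 + `|f x - f y| *+ 2 <= _); last by rewrite lerD2l.
    by rewrite le_eqVlt; apply/orP; left; apply/eqP; ring.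
  by move: h3; rewrite mulr2n lerD2r.
have : cvg (filter_from [set e | 0 < e] B).
  apply: cauchy_cvg; apply: cauchy_exP => e e0.
  have e5 : 0 < e / 5 by rewrite divr_gt0.
  have [x Bx] : B (e / 5) !=set0.
    by apply: (@filter_ex _ _ PF); exists (e / 5).
  exists x, (e / 5) => //= y By; rewrite -ball_normE /=.
  apply: (le_lt_trans (dist _ _ _ Bx By)).
  by rewrite -[e / 5 *+ 4]mulr_natr -mulrA gtr_pMr// mulrC ltr_pdivrMr// mul1r ltr_nat.
move=> /cvg_ex [p cp].
have Up : U p.
  apply: (@closed_cvg _ _ _ PF id U clU _ p cp).
  by exists 1 => //= x [].
exists p => //; apply/eqP; rewrite -subr_eq0 -normr_le0.
(* Three errors, each at most [e]: [f p - f y], [f y - y] and [y - p]. *)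
apply: (@ler_pos_mulW _ _ _ 3) => [|e e0]; first by rewrite ler0n.
have FB : filter_from [set e | 0 < e] B (B e) by exists e.
have [y [Uy ly] py] := cvg_dist_ex PF cp FB e0.
rewrite add0r -(subrKA (f y)) -[f y - p](subrKA y).
have h : `|f p - f y| <= e.
  apply: le_trans (ltW py); apply: le_trans (f2 _ _ Up Uy).
  by rewrite mulr2n lerDl.
rewrite [e * 3](_ : _ = e + (e + e)); last by ring.
apply: (le_trans (ler_normD _ _)); apply: lerD => //.
apply: (le_trans (ler_normD _ _)); apply: lerD; first exact: ltW.
by rewrite distrC ltW.
Qed.

Lemma closed_norm_le (K : numFieldType) (V : normedModType K) (c : K) :
  closed [set v : V | `|v| <= c].
Proof.
move=> v clv /=; apply/ler_addgt0Pr => e e0.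
have [w [/= wc]] := clv (ball v e) (nbhsx_ballx _ _ e0).
rewrite -ball_normE /= => vw; rewrite -(subrK w v) addrC.
apply: (le_trans (ler_normD _ _)); apply: lerD => //; exact: ltW.
Qed.

(** * C*-algebras *)

Lemma complex_archi (R : realType) (c : R[i]) : 0 <= c -> exists n, c < n%:R.
Proof.
case: c => a b; rewrite lecE /= => /andP[/eqP -> a0].
exists (Num.bound a); rewrite -(rmorph_nat (real_complex R)) ltcE /= eqxx /=.
exact: archi_boundP.
Qed.

Section CStarAlgebra.
Variables (R : realType) (A : cstarAlgType R).
Implicit Types (a b h u x y : A) (k : R[i]).

Lemma cmul_linearl b : linear (fun a => a ** b).
Proof. by move=> k x y; rewrite cmulDl cmulZl. Qed.

Lemma cmul_linearr a : linear (cmul a).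
Proof. by move=> k x y; rewrite cmulDr cmulZr. Qed.

Lemma cmul_continuousl b : continuous (fun a => a ** b).
Proof.
apply: (@linear_bound_continuous _ _ _ _ `|b|); first exact: cmul_linearl.
by move=> a; rewrite mulrC; exact: cmul_norm.
Qed.

Lemma cmul_continuousr a : continuous (cmul a).
Proof.
apply: (@linear_bound_continuous _ _ _ _ `|a|); first exact: cmul_linearr.
by move=> b; exact: cmul_norm.
Qed.

Lemma star0 : star (0 : A) = 0.
Proof. by apply: (addrI (star 0)); rewrite -starD !addr0. Qed.

Lemma starB a b : star (a - b) = star a - star b.
Proof. by apply: (addIr (star b)); rewrite -starD !subrK. Qed.

Lemma star_sum (I : Type) (r : seq I) (F : I -> A) :
  star (\sum_(i <- r) F i) = \sum_(i <- r) star (F i).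
Proof. by apply: (big_morph _ starD star0). Qed.

Lemma star_cone : star cone = cone :> A.
Proof. by rewrite -[RHS]starK -[star cone in RHS]cmul1r starM starK cmul1r. Qed.

(** The C*-identity gives [|b| ^+ 2 <= |star b| * |b|]; cancelling [|b|] and applying the result to
    [a] and to [star a] gives equality. *)
Lemma norm_star a : `|star a| = `|a|.
Proof.
have le b : `|b| <= `|star b|.
  have [->|b0] := eqVneq b 0; first by rewrite normr0.
  have n0 : 0 < `|b| by rewrite normr_gt0.
  by rewrite -(ler_pM2r n0) -expr2 -cstar_norm cmul_norm.
by apply/eqP; rewrite eq_le le -{2}(starK a) le.
Qed.

Lemma star_continuous : continuous (@star R A).
Proof.
apply: (@lipschitz_bound_continuous _ _ _ _ 1) => x y.
by rewrite -starB norm_star mul1r.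
Qed.

(** Only an inequality, since [cone] has norm [0] in the zero algebra. *)
Lemma norm_isometry_le1 u : star u ** u = cone -> `|u| <= 1.
Proof.
have c1 : `|cone : A| <= 1.
  have [->|c0] := eqVneq (cone : A) 0; first by rewrite normr0.
  have n0 : 0 < `|cone : A| by rewrite normr_gt0.
  by rewrite -(ler_pM2r n0) mul1r -expr2 -cstar_norm star_cone cmul1r.
move=> uu; rewrite -(@ler_pXn2r _ 2) ?nnegrE//.
by rewrite expr1n -cstar_norm uu.
Qed.

(* [u = h + i sqrt (1 - h^2)], where [sqrt (1 - h^2) = 1 - y] for the fixed
   point [y] of the contraction [y |-> (h^2 + y^2) / 2]. *)
Lemma selfadjoint_half_sum_unitary h : star h = h -> `|h| <= 2^-1 ->
  exists u, [/\ star u ** u = cone, u ** star u = cone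
              & h = 2^-1 *: (u + star u)].
Proof.
move=> hs hn.
(* The fixed point is sought in this closed set, stable under [f], so that it is selfadjoint and
   commutes with [h]; the norm bound makes [f] contract by one half. *)
pose U := [set y : A | `|y| <= 2^-1] `&` [set y | star y = y]
          `&` [set y | h ** y = y ** h].
pose f y := 2^-1 *: (h ** h + y ** y).
have half0 : 0 <= 2^-1 :> R[i] by rewrite invr_ge0 ler0n.
have half2 : 2^-1 + 2^-1 = 1 :> R[i].
  by rewrite -mulr2n -[_ *+ 2]mulr_natr mulVf// pnatr_eq0.
have sqn x : `|x| <= 2^-1 -> `|x ** x| <= 2^-1.
  move=> xn; apply: (le_trans (cmul_norm _ _)).
  apply: (@le_trans _ _ (2^-1 * 1)); last by rewrite mulr1.
  apply: ler_pM => //; apply: (le_trans xn).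
  by rewrite invf_le1 ?ltr0n// ler1n.
have [y [[/= yn ys] yh] fy] : exists2 y, U y & f y = y.
  apply: (@contraction_fixpoint _ _ _ _ 0 (@complex_archi R)).
  - apply: closedI; first apply: closedI.
    + exact: closed_norm_le.
    + by apply: closed_eq_continuous => [|v]; [exact: star_continuous|exact: cvg_id].
    + apply: closed_eq_continuous; [exact: cmul_continuousr|exact: cmul_continuousl].
  - split; first split => /=; first by rewrite normr0.
    + exact: star0.
    + by rewrite /= (linear_fun0 (cmul_linearr h)) (linear_fun0 (cmul_linearl h)).
  - move=> x [[/= xn xs] xh]; split; first split => /=.
    + rewrite normrZ (ger0_norm half0) -[leRHS]mulr1 ler_wpM2l// -half2.
      by apply: (le_trans (ler_normD _ _)); apply: lerD; exact: sqn.
    + rewrite starZ geC0_conj// starD !starM hs xs.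
    + done.
    + rewrite /= /f cmulZr cmulZl cmulDr cmulDl !cmulA.
      by rewrite /= in xh *; rewrite xh -[x ** h ** x]cmulA xh cmulA.
  - move=> x y [[/= xn _] _] [[/= yn _] _].
    rewrite /f -scalerBr opprD addrACA subrr add0r normrZ (ger0_norm half0).
    rewrite -[_ *+ 2]mulr_natr mulrAC mulVf ?pnatr_eq0// mul1r.
    (* Here [x ** x - y ** y = x ** (x - y) + (x - y) ** y], where the outer factors have norm at
       most one half. *)
    rewrite -(subrKA (x ** y)) -(linear_funB (cmul_linearr x)).
    rewrite -(linear_funB (cmul_linearl y)).
    apply: (le_trans (ler_normD _ _)); rewrite -[leRHS]mul1r -half2 mulrDl.
    apply: lerD; apply: (le_trans (cmul_norm _ _)); first by rewrite ler_wpM2r.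
    by rewrite mulrC ler_wpM2r.
rewrite /= in yh.
pose w := cone - y.
have ws : star w = w by rewrite /w starB star_cone ys.
have hw : h ** w = w ** h.
  rewrite /w (linear_funB (cmul_linearr h)) (linear_funB (cmul_linearl h)).
  by rewrite cmul1r cmul1l yh.
(* The fixed point equation reads [y + y = h ** h + y ** y], which says that [w = cone - y] has
   square [cone - h ** h]. *)
have ww : h ** h + w ** w = cone.
  have : y + y = h ** h + y ** y.
    by rewrite -{1 2}fy /f -scalerDl half2 scale1r.
  rewrite /w (linear_funB (cmul_linearr _)) (linear_funB (cmul_linearl _)).
  rewrite cmul1l (linear_funB (cmul_linearl _)) !cmul1r cmul1l => e.
  by rewrite -[cone - y + _]addrA -opprD [y + (y - _)]addrA e addrK addrCA subrr addr0.
have us : star (h + 'i%R *: w) = h - 'i%R *: w.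
  by rewrite starD starZ hs ws conjCi scaleNr.
exists (h + 'i%R *: w); split; rewrite us.
- rewrite (linear_funB (cmul_linearl _)) !cmulDr !cmulZl !cmulZr hw scalerA -expr2 sqrCi.
  by rewrite opprD scaleN1r opprK -addrA [_ + (- _ + _)]addrA subrr add0r.
- rewrite (linear_funB (cmul_linearr _)) !cmulDl !cmulZl !cmulZr hw scalerA -expr2 sqrCi.
  by rewrite opprD scaleN1r opprK -addrA [_ + (- _ + _)]addrA subrr add0r.
by rewrite addrACA subrr addr0 scalerDr -scalerDl half2 scale1r.
Qed.

(** A selfadjoint [h] of norm at most one half is the mean of a unitary and its adjoint, so
    [|L h| <= C]. Rescaling gives [|L h| <= 2 * C * |h|], and the real and imaginary parts of [a],
    of norm at most [|a|], contribute once each. *)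
Lemma linear_bound_unitaries (W : normedModType R[i]) (L : A -> W) (C : R[i]) :
  linear L -> (forall u, star u ** u = cone -> `|L u| <= C) ->
  forall a, `|L a| <= 4 * C * `|a|.
Proof.
move=> lL LC.
have C0 : 0 <= C.
  by apply: le_trans (LC cone _) => //; rewrite star_cone cmul1r.
have half0 : 0 <= 2^-1 :> R[i] by rewrite invr_ge0 ler0n.
have Lh h : star h = h -> `|h| <= 2^-1 -> `|L h| <= C.
  move=> hs /(selfadjoint_half_sum_unitary hs) [u [u1 u2 ->]].
  rewrite (linear_funZ lL) (linear_funD lL) normrZ (ger0_norm half0).
  rewrite mulrC ler_pdivrMr ?ltr0n//.
  apply: (le_trans (ler_normD _ _)); rewrite mulrDr mulr1.
  by apply: lerD; apply: LC; rewrite ?starK.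
have Ls h : star h = h -> `|L h| <= 2 * C * `|h|.
  move=> hs; have [->|h0] := eqVneq h 0.
    by rewrite (linear_fun0 lL) !normr0 mulr0.
  have n0 : 0 < `|h| by rewrite normr_gt0.
  have n2 : 0 < 2 * `|h| by rewrite mulr_gt0.
  have k0 : 0 <= (2 * `|h|)^-1 by rewrite invr_ge0 ltW.
  have := Lh ((2 * `|h|)^-1 *: h); rewrite starZ geC0_conj// hs => /(_ erefl).
  rewrite (linear_funZ lL) !normrZ (ger0_norm k0).
  rewrite invfM mulfVK ?gt_eqF// => /(_ (lexx _)).
  by rewrite -invfM mulrC ler_pdivrMr// mulrA [C * _]mulrC.
move=> a.
pose h := 2^-1 *: (a + star a); pose g := (- 'i%R * 2^-1) *: (a - star a).
have ea : a = h + 'i%R *: g.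
  rewrite /h /g scalerA mulrA mulrN -expr2 sqrCi opprK mul1r -scalerDr addrACA subrr addr0.
  by rewrite -mulr2n -[a *+ 2]scaler_nat scalerA mulVf ?scale1r// pnatr_eq0.
have hs : star h = h by rewrite /h starZ geC0_conj// starD starK addrC.
have gs : star g = g.
  have e : ((- 'i%R / 2)^* = 'i%R / 2 :> R[i])%R.
    by rewrite rmorphM rmorphN /= conjCi opprK geC0_conj.
  by rewrite /g starZ e starB starK -opprB scalerN -scaleNr mulNr.
have nh : `|h| <= `|a|.
  rewrite /h normrZ (ger0_norm half0) mulrC ler_pdivrMr ?ltr0n//.
  by apply: (le_trans (ler_normD _ _)); rewrite norm_star mulrDr mulr1.
have ng : `|g| <= `|a|.
  rewrite /g normrZ normrM normrN normCi mul1r (ger0_norm half0).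
  rewrite mulrC ler_pdivrMr ?ltr0n//.
  by apply: (le_trans (ler_normB _ _)); rewrite norm_star mulrDr mulr1.
rewrite {1}ea (linear_funD lL) (linear_funZ lL 'i%R g).
apply: (le_trans (ler_normD _ _)); rewrite normrZ normCi mul1r.
rewrite [4 * _ * _](_ : _ = 2 * C * `|a| + 2 * C * `|a|); last by ring.
have C20 : 0 <= 2 * C by rewrite mulr_ge0.
by apply: lerD; [apply: (le_trans (Ls _ hs))|apply: (le_trans (Ls _ gs))];
  rewrite ler_wpM2l.
Qed.

End CStarAlgebra.

(** Homomorphisms send isometries to isometries, which have norm at most one. *)
Lemma star_hom_bound (R : realType) (A B : cstarAlgType R) (f : A -> B) :
  star_hom f -> forall a, `|f a| <= 4 * `|a|.
Proof.
move=> fh a; rewrite -[4]mulr1; apply: linear_bound_unitaries.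
  exact: star_hom_linear fh.
move=> u uu; apply: norm_isometry_le1.
by rewrite -(star_hom_star fh) -(star_homM fh) uu (star_hom1 fh).
Qed.

Lemma star_hom_continuous (R : realType) (A B : cstarAlgType R) (f : A -> B) :
  star_hom f -> continuous f.
Proof.
move=> fh; apply: (@linear_bound_continuous _ _ _ _ 4).
  exact: star_hom_linear fh.
exact: star_hom_bound.
Qed.

(** * Hilbert modules and product systems *)

Section HilbertModule.
Variables (R : realType) (A : cstarAlgType R) (E : hilbertModType A).
Implicit Types (x y z : E) (k : R[i]).

Lemma ip_linear x : linear (ip x : E -> A).
Proof. by move=> k y z; rewrite ipDr ipZr. Qed.

Lemma ipDl x y z : ip (x + y) z = ip x z + ip y z :> A.
Proof. by rewrite -ip_star ipDr starD !ip_star. Qed.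

Lemma ipZl k x y : ip (k *: x) y = (k^*)%R *: ip x y :> A.
Proof. by rewrite -ip_star ipZr starZ ip_star. Qed.

Lemma ipBr x y z : ip x (y - z) = ip x y - ip x z :> A.
Proof. exact: linear_funB (ip_linear x) y z. Qed.

Lemma ipBl x y z : ip (x - y) z = ip x z - ip y z :> A.
Proof. by rewrite -ip_star ipBr starB !ip_star. Qed.

(** The first difference is [2 (<x, y> + <y, x>)]. By conjugate linearity in the first variable the
    second is [2 i (<x, y> - <y, x>)], and the factor [-i] makes the terms [<y, x>] cancel. *)
Lemma polarization x y : 4 *: ip x y =
  ip (x + y) (x + y) - ip (x - y) (x - y)
  - 'i%R *: (ip (x + 'i%R *: y) (x + 'i%R *: y) - ip (x - 'i%R *: y) (x - 'i%R *: y)) :> A.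
Proof.
have diff z : ip (x + z) (x + z) - ip (x - z) (x - z) =
    2 *: (ip x z + ip z x) :> A.
  rewrite ipDr [in X in _ - X]ipBr ipDl [ip (x + z) z]ipDl !ipBl.
  set a := ip x x; set b := ip x z; set c := ip z x; set d := ip z z.
  rewrite opprB [(b - d) + _]addrC addrACA opprB [a + c + _]addrC subrKA.
  rewrite [b + d + _]addrACA subrr addr0 scaler_nat mulr2n addrACA.
  by congr (_ + _); exact: addrC.
rewrite !diff ipZl ipZr conjCi.
set s := ip x y; set t := ip y x.
rewrite ['i%R *: (2 *: _)]scalerA mulrC -scalerA -scalerBr.
rewrite [X in _ - X]scalerDr ['i%R *: ('i%R *: s)]scalerA ['i%R *: (_ *: t)]scalerA.
rewrite mulrN -expr2 sqrCi opprK scaleN1r scale1r opprD opprK.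
rewrite [s + t + _]addrACA subrr addr0.
by rewrite -mulr2n -[s *+ 2]scaler_nat scalerA -natrM.
Qed.

(** A crude Cauchy-Schwarz inequality. On unit vectors each of the four terms of the polarization
    identity has norm at most [2 ^+ 2], which gives 16, divided by 4; the general case follows by
    scaling. *)
Lemma ip_bound x y : `|ip x y : A| <= 4 * `|x| * `|y|.
Proof.
have unit_bound (u v : E) : `|u| = 1 -> `|v| = 1 -> `|ip u v : A| <= 4.
  move=> u1 v1.
  have sq z : `|z| <= 2 -> `|ip z z : A| <= 4.
    move=> z2; rewrite -ip_norm [4](_ : _ = 2 ^+ 2); last by rewrite -natrX.
    by rewrite ler_pXn2r ?nnegrE.
  have n2 (z : E) : `|z| = 1 -> `|u + z| <= 2 /\ `|u - z| <= 2.
    move=> z1; rewrite -[2](_ : `|u| + `|z| = 2); last by rewrite u1 z1.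
    by split; [exact: ler_normD|exact: ler_normB].
  have [h1 h2] := n2 v v1.
  have [h3 h4] : `|u + 'i%R *: v| <= 2 /\ `|u - 'i%R *: v| <= 2.
    by apply: n2; rewrite normrZ normCi mul1r.
  rewrite -(@ler_pM2l _ 4) ?ltr0n// -{1}[4]ger0_norm ?ler0n// -normrZ polarization.
  apply: (le_trans (ler_normB _ _)); rewrite normrZ normCi mul1r.
  apply: (@le_trans _ _ ((4 + 4) + (4 + 4))); last first.
    by rewrite -!natrD -natrM.
  by apply: lerD; apply: (le_trans (ler_normB _ _)); apply: lerD; exact: sq.
have [->|x0] := eqVneq x 0.
  by rewrite -ip_star (linear_fun0 (ip_linear y)) star0 !normr0 mulr0 mul0r.
have [->|y0] := eqVneq y 0.
  by rewrite (linear_fun0 (ip_linear x)) !normr0 mulr0.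
have nx : 0 < `|x| by rewrite normr_gt0.
have ny : 0 < `|y| by rewrite normr_gt0.
have unit_norm (z : E) : 0 < `|z| -> `| `|z|^-1 *: z| = 1.
  by move=> z0; rewrite normrZ normfV normr_id mulVf// gt_eqF.
have := unit_bound _ _ (unit_norm _ nx) (unit_norm _ ny).
rewrite ipZl ipZr !normrZ geC0_conj ?invr_ge0// !normfV !normr_id.
rewrite ler_pdivrMl// ler_pdivrMl//.
by have -> : `|y| * (`|x| * 4) = 4 * `|x| * `|y| by ring.
Qed.

Lemma ip_continuous x : continuous (ip x : E -> A).
Proof.
by apply: (@linear_bound_continuous _ _ _ _ (4 * `|x|));
  [exact: ip_linear|exact: ip_bound].
Qed.

End HilbertModule.

Section Correspondence.
Variables (R : realType) (A : cstarAlgType R) (E : correspondenceType A).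

Lemma lact_linearl (x : E) : linear (fun a : A => lact a x).
Proof. by move=> k a b; rewrite lactDl lactZl. Qed.

(* [lact cone] need not be the identity, only a projection. *)
Lemma lact_bound (a : A) (x : E) : `|lact a x| <= 16 * `|a| * `|x|.
Proof.
(* Write [Q] for the action of [cone]. Then [|Q y|^2 = |<y, Q y>| <= 4 |y| |Q y|], and one factor
   cancels. *)
have Q1 (y : E) : `|lact (cone : A) y| <= 4 * `|y|.
  have [->|n0] := eqVneq (lact (cone : A) y) 0; first by rewrite normr0 mulr_ge0.
  have n1 : 0 < `|lact (cone : A) y| by rewrite normr_gt0.
  rewrite -(ler_pM2r n1) -expr2 ip_norm ip_lact star_cone -lactM cmul1l.
  exact: ip_bound.
have un (u : A) : star u ** u = cone -> `|lact u x| <= 4 * `|x|.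
  move=> uu; rewrite -(@ler_pXn2r _ 2) ?nnegrE// ?mulr_ge0//.
  rewrite ip_norm ip_lact -lactM uu; apply: (le_trans (ip_bound _ _)).
  have -> : (4 * `|x|) ^+ 2 = 4 * `|x| * (4 * `|x|) by ring.
  by rewrite ler_wpM2l// mulr_ge0.
apply: (le_trans (linear_bound_unitaries (lact_linearl x) un a)).
by rewrite le_eqVlt; apply/orP; left; apply/eqP; ring.
Qed.

End Correspondence.

Lemma hilbert_isometry_norm (R : realType) (A : cstarAlgType R)
    (E F : hilbertModType A) (f : E -> F) :
  (forall x, ip (f x) (f x) = ip x x :> A) -> forall x, `|f x| = `|x|.
Proof.
move=> fip x; apply/eqP; rewrite -(@eqrXn2 _ 2)//.
by rewrite !ip_norm fip.
Qed.

(** The inner square of [tau x y] is [ip y (lact (ip x x) y)]; the constants 4 of [ip_bound] and 16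
    of [lact_bound] multiply to [8 ^+ 2]. *)
Lemma interior_tensor_bound (R : realType) (A : cstarAlgType R)
    (E F T : correspondenceType A) (tau : E -> F -> T) :
  interior_tensor tau -> forall x y, `|tau x y| <= 8 * `|x| * `|y|.
Proof.
move=> tT x y; rewrite -(@ler_pXn2r _ 2) ?nnegrE ?mulr_ge0//.
rewrite ip_norm (interior_tensor_ip tT); apply: (le_trans (ip_bound _ _)).
have -> : (8 * `|x| * `|y|) ^+ 2 = 4 * `|y| * (16 * `|x| ^+ 2 * `|y|) by ring.
by rewrite ler_wpM2l ?mulr_ge0// ip_norm lact_bound.
Qed.

Section ProductSystem.
Variables (P : monoidType) (R : realType) (A : cstarAlgType R).
Variables (X : productSystem P A).

Lemma ps_mul_bound (p q : P) (x : X p) (y : X q) :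
  `|ps_mul x y| <= 8 * `|x| * `|y|.
Proof.
have [T [tau [tT [M [MU <-]]]]] := ps_unitary X p q.
rewrite (hilbert_isometry_norm (fun t => hilbert_unitary_ip MU t t)).
exact: interior_tensor_bound.
Qed.

(** Linearity is not a field of [productSystem]; it is inherited from the elementary tensor through
    the unitary [M]. *)
Lemma ps_mul_linearl (p q : P) (y : X q) : linear (fun x : X p => ps_mul x y).
Proof.
have [T [tau [tT [M [MU e]]]]] := ps_unitary X p q.
by move=> k x x'; rewrite -!e (interior_tensor_linl tT y k) (hilbert_unitary_linear MU).
Qed.

Lemma ps_mul_linearr (p q : P) (x : X p) : linear (fun y : X q => ps_mul x y).
Proof.
have [T [tau [tT [M [MU e]]]]] := ps_unitary X p q.
by move=> k y y'; rewrite -!e (interior_tensor_linr tT x k) (hilbert_unitary_linear MU).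
Qed.

Lemma ps_mul_continuousl (p q : P) (y : X q) :
  continuous (fun x : X p => ps_mul x y).
Proof.
apply: (@linear_bound_continuous _ _ _ _ (8 * `|y|)); first exact: ps_mul_linearl.
by move=> x; rewrite mulrAC; exact: ps_mul_bound.
Qed.

Lemma ps_mul_continuousr (p q : P) (x : X p) :
  continuous (fun y : X q => ps_mul x y).
Proof.
apply: (@linear_bound_continuous _ _ _ _ (8 * `|x|)); first exact: ps_mul_linearr.
by move=> y; exact: ps_mul_bound.
Qed.

Lemma in_union_inj (p : P) (x y : X p) : in_union X x = in_union X y -> x = y.
Proof. exact: existT_inj2. Qed.

(** A family of functions whose codomain does not depend on the index factors through the disjoint
    union. This replaces transport along equalities of indices. *)
Lemma in_union_fun (B : Type) (f : forall p, X p -> B) (p q : P) (x : X p) (y : X q) :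
  in_union X x = in_union X y -> f p x = f q y.
Proof. exact: (congr1 (fun z : {p : P & X p} => f (projT1 z) (projT2 z))). Qed.

(** The square of the norm of [psi p x] is that of the image of [ip x x], at most [4 * |x| ^+ 2] by
    [star_hom_bound]. *)
Lemma toeplitz_continuous (B : cstarAlgType R) (psi : forall p, X p -> B) p :
  toeplitz_rep psi -> continuous (psi p).
Proof.
move=> psiT; apply: (@linear_bound_continuous _ _ _ _ 2).
  exact: toeplitz_linear psiT p.
move=> x; rewrite -(@ler_pXn2r _ 2) ?nnegrE ?mulr_ge0//.
rewrite -cstar_norm (toeplitz_ip psiT).
apply: (le_trans (star_hom_bound (toeplitz_hom psiT) _)).
by rewrite -ip_norm exprMn -natrX.
Qed.

End ProductSystem.

(** * Representations of the twisted system *)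

Lemma star_hom_comp (R : realType) (A B C : cstarAlgType R) (f : A -> B) (g : B -> C) :
  star_hom f -> star_hom g -> star_hom (g \o f).
Proof.
move=> fh gh; split=> /= [k x y||a b|a].
- by rewrite /= (star_hom_linear fh) (star_hom_linear gh).
- by rewrite (star_hom1 fh) (star_hom1 gh).
- by rewrite (star_homM fh) (star_homM gh).
- by rewrite (star_hom_star fh) (star_hom_star gh).
Qed.

Lemma unitary_rep_comp (R : realType) (G : groupType) (A B : cstarAlgType R)
    (f : A -> B) (V : G -> A) :
  star_hom f -> unitary_rep V -> unitary_rep (f \o V).
Proof.
move=> fh Vu; split=> /= [|g h|g|g].
- by rewrite (unitary_rep1 Vu) (star_hom1 fh).
- by rewrite (unitary_repM Vu) (star_homM fh).
- by rewrite -(star_hom_star fh) -(star_homM fh) (unitary_repVl Vu) (star_hom1 fh).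
- by rewrite -(star_hom_star fh) -(star_homM fh) (unitary_repVr Vu) (star_hom1 fh).
Qed.

Lemma unitary_repV (R : realType) (G : groupType) (B : cstarAlgType R)
    (U : G -> B) g : unitary_rep U -> star (U g) = U g^-1%g.
Proof.
move=> Uu; rewrite -[LHS]cmul1r -(unitary_rep1 Uu) -(mulgV g) (unitary_repM Uu).
by rewrite cmulA (unitary_repVl Uu) cmul1l.
Qed.

Section TwistedSystem.
Variables (R : realType) (P : monoidType) (G : groupType).
Variables (zs : zappaSzep P G) (A : cstarAlgType R) (X : productSystem P A).
Variable beta : zsAction zs X.
Variables (AG : crossedProduct (zs_coef beta)) (Z : twistedSystem AG).
Variable B : cstarAlgType R.

Lemma zs_coef1 a : zs_coef beta 1%g a = a.
Proof.
apply: (bij_inj (ps_unit_bij X)); apply: in_union_inj.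
by rewrite -zs_beta_coef zs_beta1.
Qed.

Lemma tw_unit_coef a : tw_tens Z (ps_unit X a) 1%g = ps_unit Z (cp_coef AG a).
Proof. by rewrite -tw_unit (unitary_rep1 (cp_grp_rep AG)) cmul1r. Qed.

Lemma tw_unit_grp g : tw_tens Z (ps_unit X cone) g = ps_unit Z (cp_grp AG g).
Proof. by rewrite -tw_unit (star_hom1 (cp_coef_hom AG)) cmul1l. Qed.

Lemma toeplitz_eq_on_tens (Psi Psi' : forall p, Z p -> B) :
  toeplitz_rep Psi -> toeplitz_rep Psi' ->
  (forall p (x : X p) g, Psi p (tw_tens Z x g) = Psi' p (tw_tens Z x g)) ->
  Psi = Psi'.
Proof.
move=> PsiT PsiT' e; apply: functional_extensionality_dep => p.
apply: funext; apply: (eq_linear_dense (tw_tens_dense Z p)).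
- exact: toeplitz_linear PsiT p.
- exact: toeplitz_linear PsiT' p.
- exact: toeplitz_continuous PsiT.
- exact: toeplitz_continuous PsiT'.
- by move=> _ [x [g ->]].
Qed.

(** * From a representation of the twisted system to a covariant pair *)

Section Restriction.
Variable Psi : forall p, Z p -> B.
Hypothesis PsiT : toeplitz_rep Psi.

Let psi p (x : X p) := Psi (tw_tens Z x 1%g).
Let U g := Psi (tw_tens Z (ps_unit X cone) g).

(** In the twisted system the product of [x] (x) [e] and [1] (x) [g] is [x] (x) [g], as the identity
    of [G] acts trivially and restricts to itself. *)
Lemma toeplitz_tens p (x : X p) g : Psi (tw_tens Z x g) = psi x ** U g.
Proof.
rewrite /psi /U (toeplitz_mul PsiT) (in_union_fun Psi (tw_mul Z _ _ _ _)).
rewrite zs_res1 mul1g; symmetry.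
apply: (in_union_fun (fun q (y : X q) => Psi (tw_tens Z y g))).
(* This equation relates elements over different indices, so multiplication by [x] is applied to it
   as a function on the disjoint union. *)
have e := zs_beta1 beta (ps_unit X cone).
rewrite (in_union_fun (fun q (y : X q) => in_union X (ps_mul x y)) e).
by rewrite ps_mul_unitr ract1.
Qed.

Lemma restriction_toeplitz : toeplitz_rep psi.
Proof.
split.
- move=> p k x y; rewrite /psi (tw_tens_linear Z 1%g k).
  exact: toeplitz_linear PsiT p _ _ _.
- have -> : (fun a => psi (ps_unit X a)) =
      (fun a => Psi (ps_unit Z a)) \o cp_coef AG.
    by apply: funext => a; rewrite /psi tw_unit_coef.
  exact: star_hom_comp (cp_coef_hom AG) (toeplitz_hom PsiT).
- move=> p q x y.
  rewrite /psi (toeplitz_mul PsiT) (in_union_fun Psi (tw_mul Z _ _ _ _)).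
  rewrite zs_res1 mul1g.
  apply: (in_union_fun (fun q (y : X q) => Psi (tw_tens Z y 1%g))).
  exact: (in_union_fun (fun q (y : X q) => in_union X (ps_mul x y)) (zs_beta1 beta y)).
- move=> p x y; rewrite /psi (toeplitz_ip PsiT) tw_ip invg1 mulg1 zs_coef1.
  by rewrite tw_unit.
Qed.

(** The product of [1] (x) [g] and [x] (x) [e] is the tensor of [beta_g x] and [g|_p], which
    [toeplitz_tens] splits again. *)
Lemma restriction_covariant : covariant_rep beta psi U.
Proof.
have psiT := restriction_toeplitz.
split=> //.
  have -> : U = (fun a => Psi (ps_unit Z a)) \o cp_grp AG.
    by apply: funext => g; rewrite /U tw_unit_grp.
  exact: unitary_rep_comp (toeplitz_hom PsiT) (cp_grp_rep AG).
move=> p g x.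
rewrite {1}/U {1}/psi (toeplitz_mul PsiT) (in_union_fun Psi (tw_mul Z _ _ _ _)).
rewrite mulg1 toeplitz_tens -(toeplitz_mul psiT) (star_hom1 (toeplitz_hom psiT)).
by rewrite cmul1l.
Qed.

End Restriction.

(** * From a covariant pair to a representation of the twisted system *)

Section Extension.
Variables (psi : forall p, X p -> B) (U : G -> B).
Hypothesis psiU : covariant_rep beta psi U.

Let psiT : toeplitz_rep psi := covariant_toeplitz psiU.
Let Uu : unitary_rep U := covariant_unitary psiU.

(** The covariance relation over the identity of [P], where [g|_e = g]. It is the hypothesis of the
    universal property of the crossed product. *)
Lemma covariant_coef g a :
  U g ** psi (ps_unit X a) = psi (ps_unit X (zs_coef beta g a)) ** U g.
Proof.
rewrite (covariant_rel psiU) zs_res_e; congr (_ ** _).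
exact: in_union_fun (zs_beta_coef beta g a).
Qed.

Lemma covariant_integrated_form : exists Phi : AG -> B,
  star_hom Phi /\
  forall a g, Phi (cp_coef AG a ** cp_grp AG g) = psi (ps_unit X a) ** U g.
Proof.
have [Phi [Phih Phia Phig]] :=
  cp_universal AG (toeplitz_hom psiT) Uu covariant_coef.
by exists Phi; split=> // a g; rewrite (star_homM Phih) Phia Phig.
Qed.

(** A relation rather than a function: a vector may have several expansions into elementary tensors,
    and only the bound below shows that the sums in [B] agree. Scalars are absorbed into the first
    tensor factor. *)
Definition tens_relation p (z : Z p) (b : B) : Prop :=
  exists l : seq (X p * G), z = \sum_(i <- l) tw_tens Z i.1 i.2 /\
                            b = \sum_(i <- l) psi i.1 ** U i.2.

Lemma tens_relation_tens p (x : X p) g :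
  tens_relation (tw_tens Z x g) (psi x ** U g).
Proof. by exists [:: (x, g)]; rewrite !big_seq1. Qed.

Lemma tens_relation_linear p (k : R[i]) (z z' : Z p) (b b' : B) :
  tens_relation z b -> tens_relation z' b' ->
  tens_relation (k *: z + z') (k *: b + b').
Proof.
move=> [l [-> ->]] [l' [-> ->]].
exists ([seq (k *: i.1, i.2) | i <- l] ++ l'); rewrite !big_cat !big_map /=.
split; congr (_ + _); rewrite scaler_sumr; apply: eq_bigr => i _.
  by rewrite (linear_funZ (tw_tens_linear Z i.2)).
by rewrite (linear_funZ (toeplitz_linear psiT (p:=p))) cmulZl.
Qed.

Lemma tens_relation_dense p :
  closure [set z : Z p | exists b, tens_relation z b] = setT.
Proof.
apply/seteqP; split=> // z _; move: (tw_tens_dense Z p) => /seteqP[_ /(_ z I)].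
apply: closure_subset => _ [n [c [w [Sw ->]]]] /=.
elim/big_ind : _ => [|z1 z2 [b1 h1] [b2 h2]|i _].
- by exists 0, [::]; rewrite !big_nil.
- exists (1 *: b1 + b2); rewrite -[z1]scale1r; exact: tens_relation_linear.
- have [x [g ->]] := Sw i.
  exists (c i *: (psi x ** U g) + 0); rewrite -[_ *: _]addr0.
  apply: tens_relation_linear; first exact: tens_relation_tens.
  by exists [::]; rewrite !big_nil.
Qed.

Variable Phi : AG -> B.
Hypothesis Phih : star_hom Phi.
Hypothesis Phi_gen :
  forall a g, Phi (cp_coef AG a ** cp_grp AG g) = psi (ps_unit X a) ** U g.

(** Both sides equal [U g^-1 ** psi <x, y> ** U h]: on the right, [covariant_coef] moves [U g^-1]
    across the coefficient. *)
Lemma tens_star_mul p (x y : X p) g h :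
  star (psi x ** U g) ** (psi y ** U h) =
  Phi (ip (tw_tens Z x g) (tw_tens Z y h)).
Proof.
rewrite tw_ip Phi_gen (unitary_repM Uu) [RHS]cmulA -covariant_coef starM.
rewrite -(toeplitz_ip psiT) (unitary_repV _ Uu).
by rewrite !cmulA.
Qed.

Lemma tens_relation_star_mul p (z : Z p) b :
  tens_relation z b -> star b ** b = Phi (ip z z).
Proof.
move=> [l [-> ->]].
rewrite star_sum (linear_fun_sum (cmul_linearl _)).
rewrite (linear_fun_sum (ip_linear _)) (linear_fun_sum (star_hom_linear Phih)).
under eq_bigr do rewrite (linear_fun_sum (cmul_linearr _)).
rewrite exchange_big; apply: eq_bigr => j _.
(* [ip] is linear in its second variable only, so the sum in the first is expanded through the
   adjoint. *)
rewrite -ip_star (linear_fun_sum (ip_linear _)) star_sum.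
rewrite (linear_fun_sum (star_hom_linear Phih)); apply: eq_bigr => i _.
by rewrite ip_star tens_star_mul.
Qed.

(** The C*-identity applied to [star b ** b = Phi (ip z z)]. With the linearity of the relation it
    implies that [z] determines [b]. *)
Lemma tens_relation_bound p (z : Z p) b : tens_relation z b -> `|b| <= 2 * `|z|.
Proof.
move=> /tens_relation_star_mul e; rewrite -(@ler_pXn2r _ 2) ?nnegrE ?mulr_ge0//.
rewrite -cstar_norm e; apply: (le_trans (star_hom_bound Phih _)).
by rewrite -ip_norm exprMn -natrX.
Qed.

(** * The identities of a representation, from elementary tensors to whole fibers *)

Section Toeplitz.
Variable Psi : forall p, Z p -> B.
Hypothesis Psil : forall p, linear (@Psi p).
Hypothesis Psic : forall p, continuous (@Psi p).
Hypothesis Psit : forall p (x : X p) g, Psi (tw_tens Z x g) = psi x ** U g.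

(** The inverse [v] of the identification [ps_unit Z] is linear and isometric, so [Phi \o v] is
    continuous. It agrees with [Psi] on elementary tensors, because every element of the identity
    fiber of [X] comes from a coefficient. *)
Lemma extension_unit a : Psi (ps_unit Z a) = Phi a.
Proof.
have [v vK Kv] := ps_unit_bij Z.
have vl : linear v.
  move=> k x y; apply: (bij_inj (ps_unit_bij Z)).
  by rewrite Kv (ps_unit_linear Z k) !Kv.
have vc : continuous v.
  apply: (@linear_bound_continuous _ _ _ _ 1) => // x.
  rewrite mul1r -{2}(Kv x) -(@ler_pXn2r _ 2) ?nnegrE//.
  by rewrite [leRHS]ip_norm ps_unit_ip cstar_norm.
rewrite -{2}(vK a).
apply: (eq_linear_dense (g := Phi \o v) (tw_tens_dense Z 1%g)).
- exact: Psil.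
- by move=> k x y; rewrite /= vl (star_hom_linear Phih).
- exact: Psic.
- move=> z; apply: continuous_comp; first exact: vc.
  exact: star_hom_continuous Phih _.
- move=> _ [x [g ->]] /=; have [w _ Kw] := ps_unit_bij X.
  by rewrite -(Kw x) -tw_unit vK Phi_gen tw_unit Psit.
Qed.

(** Both sides are conjugate linear in [z], so density is used only in the second variable: first
    with [z] an elementary tensor, then with [z] arbitrary, where taking adjoints exchanges the two
    arguments. *)
Lemma extension_ip p (z w : Z p) : star (Psi z) ** Psi w = Phi (ip z w).
Proof.
have lin (z0 : Z p) : linear (fun w0 : Z p => star (Psi z0) ** Psi w0).
  by move=> k x y; rewrite Psil cmul_linearr.
have lin' (z0 : Z p) : linear (fun w0 : Z p => Phi (ip z0 w0)).
  by move=> k x y; rewrite ip_linear (star_hom_linear Phih).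
have cts (z0 : Z p) : continuous (fun w0 : Z p => star (Psi z0) ** Psi w0).
  move=> w0; apply: (continuous_comp (@Psic p w0)).
  exact: cmul_continuousr.
have cts' (z0 : Z p) : continuous (fun w0 : Z p => Phi (ip z0 w0)).
  move=> w0; apply: (continuous_comp (@ip_continuous _ _ _ z0 w0)).
  exact: star_hom_continuous Phih _.
have tens_l (x : X p) g (w0 : Z p) :
    star (Psi (tw_tens Z x g)) ** Psi w0 = Phi (ip (tw_tens Z x g) w0).
  apply: (eq_linear_dense (tw_tens_dense Z p) (lin _) (lin' _)) => //.
  by move=> _ [y [h ->]]; rewrite !Psit tens_star_mul.
apply: (eq_linear_dense (tw_tens_dense Z p) (lin z) (lin' z)) => //.
move=> _ [y [h ->]]; rewrite -[LHS]starK starM starK tens_l.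
by rewrite -(star_hom_star Phih) ip_star.
Qed.

(** On elementary tensors, covariance moves [U g] past [psi y] and leaves [U] at [g|_q]. Density is
    then applied in each variable in turn. *)
Lemma extension_mul p q (z : Z p) (w : Z q) : Psi z ** Psi w = Psi (ps_mul z w).
Proof.
have tens2 (x : X p) g (y : X q) h :
    Psi (tw_tens Z x g) ** Psi (tw_tens Z y h) =
    Psi (ps_mul (tw_tens Z x g) (tw_tens Z y h)).
  rewrite (in_union_fun Psi (tw_mul Z _ _ _ _)) !Psit -(toeplitz_mul psiT).
  rewrite (unitary_repM Uu) -!cmulA; congr (_ ** _).
  by rewrite !cmulA (covariant_rel psiU).
have tens_l (x : X p) g (w0 : Z q) :
    Psi (tw_tens Z x g) ** Psi w0 = Psi (ps_mul (tw_tens Z x g) w0).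
  apply: (eq_linear_dense (tw_tens_dense Z q)
    (f := fun w0 => Psi (tw_tens Z x g) ** Psi w0)
    (g := fun w0 => Psi (ps_mul (tw_tens Z x g) w0))).
  - by move=> k a b; rewrite Psil cmul_linearr.
  - by move=> k a b; rewrite ps_mul_linearr Psil.
  - move=> w1; apply: (continuous_comp (@Psic q w1)); exact: cmul_continuousr.
  - move=> w1; apply: (continuous_comp (@ps_mul_continuousr _ _ _ _ _ _ _ w1)).
    exact: Psic.
  - by move=> _ [y [h ->]].
apply: (eq_linear_dense (tw_tens_dense Z p)
  (f := fun z => Psi z ** Psi w) (g := fun z => Psi (ps_mul z w))).
- by move=> k a b; rewrite Psil (cmul_linearl (Psi w)).
- by move=> k a b; rewrite (ps_mul_linearl w k) Psil.
- move=> z1; apply: (@continuous_comp _ _ _ _ (fun b => b ** Psi w) _ (@Psic p z1)).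
  exact: cmul_continuousl.
- move=> z1; apply: (continuous_comp (@ps_mul_continuousl _ _ _ _ _ _ w z1)).
  exact: Psic.
- by move=> _ [x [g ->]].
Qed.

Lemma extension_toeplitz : toeplitz_rep Psi.
Proof.
split=> //.
- have -> // : (fun a => Psi (ps_unit Z a)) = Phi.
  by apply: funext; exact: extension_unit.
- exact: extension_mul.
- by move=> p x y; rewrite extension_unit extension_ip.
Qed.

End Toeplitz.

End Extension.

(** In each fiber [tens_relation] is linear, bounded and densely defined, hence extends to a
    continuous linear map. This yields surjectivity of the correspondence. *)
Lemma covariant_extension (psi : forall p, X p -> B) (U : G -> B) :
  covariant_rep beta psi U ->
  exists2 Psi : forall p, Z p -> B, toeplitz_rep Psi &
    forall p (x : X p) g, Psi p (tw_tens Z x g) = psi p x ** U g.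
Proof.
move=> psiU; have [Phi [Phih Phi_gen]] := covariant_integrated_form psiU.
have ext p := bounded_relation_extension
  (fun k z z' b b' => @tens_relation_linear _ _ psiU p k z z' b b')
  (@tens_relation_bound _ _ psiU _ Phih Phi_gen p)
  (tens_relation_dense psiU p).
pose Psi p := projT1 (cid (ext p)).
have PsiP p : [/\ linear (Psi p), continuous (Psi p)
    & forall z b, tens_relation psi U z b -> Psi p z = b] := projT2 (cid (ext p)).
have Psit p (x : X p) g : Psi p (tw_tens Z x g) = psi p x ** U g.
  by have [_ _] := PsiP p; apply; exact: tens_relation_tens.
exists Psi => //; apply: (extension_toeplitz psiU Phih Phi_gen) => // p.
  by have [] := PsiP p.
by have [] := PsiP p.
Qed.

End TwistedSystem.

Theorem theorem4p5 (R : realType) (P : monoidType) (G : groupType)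
    (zs : zappaSzep P G) (A : cstarAlgType R) (X : productSystem P A)
    (beta : zsAction zs X) (hzs : homogeneous zs)
    (AG : crossedProduct (zs_coef beta)) (Z : twistedSystem AG)
    (B : cstarAlgType R) :
  exists Pi : (forall p, Z p -> B) -> (forall p, X p -> B) * (G -> B),
    [/\ set_bij [set Psi | toeplitz_rep Psi]
                [set c | covariant_rep beta c.1 c.2] Pi,
        forall Psi : forall p, Z p -> B, toeplitz_rep Psi ->
          (forall p (x : X p), (Pi Psi).1 p x = Psi p (tw_tens Z x 1%g)) /\
          (forall g, (Pi Psi).2 g = Psi 1%g (tw_tens Z (ps_unit X cone) g))
      & forall (psi : forall p, X p -> B) (U : G -> B),
          covariant_rep beta psi U ->
          forall Psi : forall p, Z p -> B, toeplitz_rep Psi ->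
            Pi Psi = (psi, U) ->
            forall p (x : X p) g, Psi p (tw_tens Z x g) = psi p x ** U g].
Proof.
exists (fun Psi : forall p, Z p -> B =>
  (fun p (x : X p) => Psi p (tw_tens Z x 1%g),
   fun g => Psi 1%g (tw_tens Z (ps_unit X cone) g))).
split=> //.
- split=> [Psi PsiT||].
  + exact: restriction_covariant.
  (* Injectivity: by [toeplitz_tens] the pair determines the values on elementary tensors. *)
  + move=> Psi Psi' /set_mem PsiT /set_mem PsiT' [e1 e2].
    apply: (toeplitz_eq_on_tens PsiT PsiT') => p x g.
    rewrite (toeplitz_tens PsiT) (toeplitz_tens PsiT').
    have -> : Psi p (tw_tens Z x 1%g) = Psi' p (tw_tens Z x 1%g).
      exact: (congr1 (fun f : forall p, X p -> B => f p x) e1).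
    by have -> := congr1 (fun f : G -> B => f g) e2.
  (* Surjectivity: restricting the extension gives back the pair, since [U] at the identity and
     [psi] at the unit of the coefficient algebra are both [cone]. *)
  + move=> [psi U] /= psiU; have [Psi PsiT Psit] := covariant_extension Z psiU.
    exists Psi => //; congr pair.
      apply: functional_extensionality_dep => p; apply: funext => x.
      by rewrite Psit (unitary_rep1 (covariant_unitary psiU)) cmul1r.
    apply: funext => g.
    rewrite Psit (star_hom1 (toeplitz_hom (covariant_toeplitz psiU))).
    by rewrite cmul1l.
- by move=> psi U _ Psi PsiT [<- <-] p x g; exact: toeplitz_tens.
Qed.
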